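(* Let $\alpha\neq 0$ and $\zeta>1$ be real algebraic numbers such that the pair $(\alpha,\zeta)$ is not of the form $(\alpha,\zeta)=\left(\frac{A}{B}M^{-\frac{g}{L}},M^{\frac{1}{L}}\right)$ with integers $L,M,g>0$ and nonzero integers $A,B$. Then $\overline{\sigma}(\alpha,\zeta)<\infty$. In particular, for any real algebraic $\zeta>1$ not of the form $\sqrt[L]{M}$ for integers $L,M$ and any real algebraic $\alpha\neq 0$ we have $\overline{\sigma}(\alpha,\zeta)<\infty$.
   Context: For real $x$, $\Vert x\Vert$ denotes the distance from $x$ to the nearest integer. For real $\alpha\neq 0$ and $\zeta>1$, $$\overline{\sigma}(\alpha,\zeta):=\limsup_{n\to\infty}-\frac{\log\Vert\alpha\zeta^{n}\Vert}{n\log\zeta},$$ where $n$ runs through the positive integers and the quotient is read as $+\infty$ when $\Vert\alpha\zeta^n\Vert=0$. *)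

(* Defs.v *)
From HB Require Import structures.
From mathcomp Require Import all_boot all_order all_algebra.
From mathcomp Require Import all_classical all_reals all_analysis.

Set Implicit Arguments.
Unset Strict Implicit.
Unset Printing Implicit Defensive.

Import Order.TTheory GRing.Theory Num.Theory.
Import numFieldNormedType.Exports.

Local Open Scope classical_set_scope.
Local Open Scope ring_scope.

Definition algebraic_real (R : realType) (x : R) : Prop :=
  algebraicOver (ratr : rat -> R) x.

Definition dist_int (R : realType) (x : R) : R :=
  inf [set `|x - m%:~R| | m in [set: int]].

Definition sigma_quot (R : realType) (alpha zeta : R) (n : nat) : \bar R :=
  if dist_int (alpha * zeta ^+ n) == 0 then +oo%E
  else (- ln (dist_int (alpha * zeta ^+ n)) / (n%:R * ln zeta))%:E.

(* The shift makes the exponent run through the positive integers. *)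
Definition sigma_bar (R : realType) (alpha zeta : R) : \bar R :=
  limn_esup (fun n : nat => sigma_quot alpha zeta n.+1).

(* Main.v *)
Require Import Defs.
From mathcomp Require Import all_boot all_order all_algebra.
From mathcomp Require Import all_classical all_reals all_analysis.
From mathcomp Require Import fingroup perm separable.
From mathcomp Require Import ring.

Import Order.TTheory GRing.Theory Num.Theory.
Import numFieldNormedType.Exports.

Local Open Scope ring_scope.

(** The proof separates the exponents [n] for which [alpha * zeta ^+ n] is an
    integer from the others.

    When [alpha * zeta ^+ n] differs from the integer [m], a Liouville
    inequality bounds [`|alpha * zeta ^+ n - m|] below by [(c * k ^+ n)^-1]
    with [c] and [k] independent of [n] and [m] ([liouville_power]).  To obtain
    it, let [v] be the vector of powers [1, theta, ..., theta ^+ d] of a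
    primitive element of the number field [Q(alpha, zeta)].  Multiplication by
    [alpha] and by [zeta] acts on [v] through integer matrices, up to
    denominators, so [alpha * zeta ^+ n - m] times an integer that
    grows geometrically with [n] is an eigenvalue, for [v], of an integer matrix with entries of at
    most exponential size.  Since the entries of [v] are linearly independent
    over the rationals, that matrix is invertible as soon as the eigenvalue is
    nonzero; its determinant is then a nonzero integer, and Cramer's rule
    bounds it by the eigenvalue times an exponential
    ([eigenvalue_lower_bound]).  The determinant plays the role of the norm,
    and its cofactors that of the product of the other conjugates.

    If, on the other hand, [alpha * zeta ^+ n] is an integer for arbitrarily
    large [n], the quotient of two such values shows that some power
    [zeta ^+ L] is rational, and that the powers of this rational number have
    bounded denominator; it is therefore an integer [M], and the pair is
    exceptional ([exceptional_of_integer_values]).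

    So a non-exceptional pair takes only non-integral values from some
    exponent on, and the quotients defining the limit superior are
    eventually at most [(ln c + ln k) / ln zeta]. *)

(** * Integer matrices representing algebraic numbers *)

Lemma common_denominator (T : finType) (f : T -> rat) :
  exists2 D : int, D != 0 & forall t, D%:~R * f t \is a Num.int.
Proof.
exists (\prod_t denq (f t)); first by apply/prodf_neq0 => t _; rewrite denq_neq0.
move=> t; rewrite (bigD1 t) //= rmorphM /= mulrAC [_ * f t]mulrC -numqE.
by rewrite -rmorphM /= intr_int.
Qed.

(** The integer [D] absorbs the denominators: [x] may fail to be an algebraic
    integer. *)
Definition int_represents {R : realType} (d : nat) (v : 'cV[R]_d.+1) (x : R) :=
  exists (D : int) (M : 'M[int]_d.+1),
    D != 0 /\ map_mx intr M *m v = (D%:~R * x) *: v.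

Lemma primitive_pair {R : realType} (alpha zeta : R) :
    algebraic_real alpha -> algebraic_real zeta ->
  exists theta : R, [/\ algebraic_real theta,
    exists a : {poly rat}, alpha = (map_poly ratr a).[theta]
    & exists z : {poly rat}, zeta = (map_poly ratr z).[theta]].
Proof.
move=> alg_alpha alg_zeta.
have [p p_neq0 pa0] := alg_alpha; have [q q_neq0 qz0] := alg_zeta.
have [n [[a Da] [z Dz]]] := pchar0_PET p_neq0 pa0 q_neq0 qz0 (pchar_num _).
exists (zeta *+ n - alpha); split; [| by exists a | by exists z].
apply: algebraic_sub => //; rewrite -mulr_natl; apply: algebraic_mul => //.
by rewrite -(ratr_nat R); apply: algebraic_id.
Qed.

(** The last clause is the linear independence of [1, theta, ..., theta ^+ d]
    over the rationals.  The size has the form [d.+2] because a nonzero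
    constant has no root. *)
Lemma minimal_polynomial {R : realType} (theta : R) :
    algebraic_real theta ->
  exists (d : nat) (m : {poly rat}),
    [/\ size m = d.+2, (map_poly ratr m).[theta] = 0
      & forall w : {poly rat}, (size w <= d.+1)%N ->
          (map_poly ratr w).[theta] = 0 -> w = 0].
Proof.
move=> [p p_neq0 /rootP pt0].
pose P n := `[< exists2 m : {poly rat}, m != 0 &
                  (map_poly ratr m).[theta] = 0 /\ size m = n >].
have exP : exists n, P n by exists (size p); apply/asboolP; exists p.
have [n /asboolP[m m_neq0 [mt0 sz_m]] min_n] := ex_minnP exP.
have min_m (w : {poly rat}) : (size w < n)%N -> (map_poly ratr w).[theta] = 0 -> w = 0.
  move=> w_small wt0; apply/eqP; apply: contraTT w_small => w_neq0.
  by rewrite -leqNgt; apply: min_n; apply/asboolP; exists w.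
case: n => [|[|d]] in sz_m min_m min_n *.
- by rewrite -size_poly_eq0 sz_m in m_neq0.
- have /size_poly1P[c c_neq0 Dm] : size m == 1%N by rewrite sz_m.
  by move: mt0; rewrite Dm map_polyC hornerC => /eqP; rewrite fmorph_eq0 (negPf c_neq0).
- by exists d, m; split.
Qed.

Lemma horner_rVpoly_ratr {R : realType} d (w : 'rV[rat]_d) (theta : R) :
  (map_poly ratr (rVpoly w)).[theta] = \sum_i ratr (w 0 i) * theta ^+ i.
Proof.
rewrite (@horner_coef_wide _ d); last first.
  by rewrite size_map_poly; apply: size_poly.
by apply: eq_bigr => i _; rewrite coef_map /= coef_rVpoly_ord.
Qed.

(** Multiplication by [f.[theta]] sends [theta ^+ i] to the value at [theta] of
    [(f * 'X^i) %% m], whose coefficients form row [i] of the matrix. *)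
Lemma power_basis_represents {R : realType} (theta : R) d (m f : {poly rat}) :
    size m = d.+2 -> (map_poly ratr m).[theta] = 0 ->
  int_represents d (\col_i theta ^+ i) (map_poly ratr f).[theta].
Proof.
move=> sz_m mt0; have m_neq0 : m != 0 by rewrite -size_poly_eq0 sz_m.
pose g (ij : 'I_d.+1 * 'I_d.+1) : rat := (poly_rV ((f * 'X^(ij.1)) %% m) : 'rV_d.+1) 0 ij.2.
have [D D_neq0 D_int] := common_denominator _ g.
exists D, (\matrix_(i, j) Num.floor (D%:~R * g (i, j))); split => //.
apply/colP => i; rewrite !mxE.
transitivity (\sum_j D%:~R * (ratr (g (i, j)) * theta ^+ j)).
  apply: eq_bigr => j _; rewrite !mxE mulrA -(ratr_int R (Num.floor _)).
  by rewrite (floorK (D_int _)) rmorphM /= ratr_int.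
rewrite -mulr_sumr -mulrA; congr (_ * _).
pose r := (f * 'X^i) %% m.
transitivity ((map_poly ratr (rVpoly (poly_rV r : 'rV_d.+1))).[theta]).
  by rewrite horner_rVpoly_ratr.
rewrite poly_rV_K; last by rewrite -ltnS -sz_m ltn_modp.
have := congr1 (fun p => (map_poly ratr p).[theta]) (divp_eq (f * 'X^i) m).
rewrite /= rmorphD !rmorphM /= map_polyXn hornerD !hornerM hornerXn mt0 mulr0 add0r.
by move=> ->.
Qed.

(** This is the multiplication action of the number field [Q(alpha, zeta)] on a
    rational basis of it; the normalisation [v 0 0 = 1] makes an entry of
    [\adj M *m (M *m v)] equal to a determinant. *)
Lemma integral_model {R : realType} (alpha zeta : R) :
    algebraic_real alpha -> algebraic_real zeta ->
  exists (d : nat) (v : 'cV[R]_d.+1),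
    [/\ v 0 0 = 1,
        forall w : 'rV[int]_d.+1, map_mx intr w *m v = 0 -> w = 0,
        int_represents d v alpha & int_represents d v zeta].
Proof.
move=> alg_alpha alg_zeta.
have [theta [alg_theta [a ->] [z ->]]] := primitive_pair alpha zeta alg_alpha alg_zeta.
have [d [m [sz_m mt0 min_m]]] := minimal_polynomial theta alg_theta.
exists d, (\col_i theta ^+ i); split; first by rewrite mxE expr0.
- move=> w /matrixP/(_ 0 0); rewrite !mxE => wv0.
  have w0 : rVpoly (map_mx intr w : 'rV[rat]_d.+1) = 0.
    apply: min_m; first exact: size_poly.
    by rewrite horner_rVpoly_ratr; apply: etrans wv0; apply: eq_bigr => j _; rewrite !mxE ratr_int.
  apply/rowP => i; apply/eqP; rewrite mxE -(intr_eq0 rat).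
  by have := congr1 (fun p : {poly rat} => p`_i) w0; rewrite coef0 coef_rVpoly_ord mxE => ->.
- exact: power_basis_represents sz_m mt0.
- exact: power_basis_represents sz_m mt0.
Qed.

(** * A Liouville inequality along a geometric progression *)

Lemma det_norm_le {F : numDomainType} n (A : 'M[F]_n) (B : F) :
  (forall i j, `|A i j| <= B) -> `|\det A| <= n`!%:R * B ^+ n.
Proof.
move=> leB; apply: le_trans (ler_norm_sum _ _ _) _.
rewrite -[in leRHS]card_Sn mulr_natl -sumr_const; apply: ler_sum => s _.
rewrite normrM normrX normrN1 expr1n mul1r normr_prod.
rewrite -[in leRHS](card_ord n) -prodr_const; apply: ler_prod => i _.
by rewrite normr_ge0 leB.
Qed.

(** A row vector [w] killed by [M] satisfies [x *: (w *m v) = 0], so the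
    independence of the entries of [v] makes [\det M] a nonzero integer.  The
    identity [\adj M *m M = (\det M)%:M] applied to [v] then exhibits [x] as a
    factor of [\det M], with a cofactor controlled by the entries of [M]. *)
Lemma eigenvalue_lower_bound {R : realType} d (v : 'cV[R]_d.+1) (M : 'M[int]_d.+1) (x B : R) :
    v 0 0 = 1 -> (forall w : 'rV[int]_d.+1, map_mx intr w *m v = 0 -> w = 0) ->
    map_mx intr M *m v = x *: v -> x != 0 -> (forall i j, `|(M i j)%:~R| <= B) ->
  1 <= `|x| * (d`!%:R * B ^+ d * \sum_i `|v i 0|).
Proof.
move=> v00 v_free Mv x_neq0 leB.
have detM_neq0 : \det M != 0.
  apply/det0P => -[w w_neq0 wM0]; case/eqP: w_neq0; apply: v_free.
  apply/eqP; have /eqP : x *: (map_mx intr w *m v) = 0.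
    by rewrite scalemxAr -Mv mulmxA -map_mxM wM0 map_mx0 mul0mx.
  by rewrite scaler_eq0 (negPf x_neq0).
pose Mr : 'M[R]_d.+1 := map_mx intr M.
have det_ge1 : 1 <= `|\det Mr|.
  by rewrite det_map_mx; apply: norm_intr_ge1; rewrite ?intr_int ?intr_eq0.
apply: le_trans det_ge1 _.
have -> : \det Mr = x * (\adj Mr *m v) 0 0.
  have : \adj Mr *m (Mr *m v) = \det Mr *: v by rewrite mulmxA mul_adj_mx mul_scalar_mx.
  by rewrite Mv -scalemxAr => /matrixP/(_ 0 0); rewrite !mxE v00 mulr1.
rewrite normrM ler_wpM2l // mxE; apply: le_trans (ler_norm_sum _ _ _) _.
rewrite mulr_sumr; apply: ler_sum => j _; rewrite normrM ler_wpM2r // mxE.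
rewrite /cofactor normrM normrX normrN1 expr1n mul1r.
by apply: det_norm_le => i k; rewrite !mxE.
Qed.

(** The sum of the absolute values of all entries is submultiplicative, so the
    entries of the matrix for [alpha * zeta ^+ n], the one of [alpha] times
    the [n]-th power of the one of [zeta], grow at most geometrically. *)
Lemma powers_represented {R : realType} d (v : 'cV[R]_d.+1) (alpha zeta : R) :
    int_represents d v alpha -> int_represents d v zeta ->
  exists (Da Dz : int) (C K : R),
    [/\ Da != 0, Dz != 0, 0 <= C, 0 <= K
      & forall n, exists M : 'M[int]_d.+1,
          map_mx intr M *m v = (Da%:~R * Dz%:~R ^+ n * (alpha * zeta ^+ n)) *: v
          /\ forall i j, `|(M i j)%:~R| <= C * K ^+ n].
Proof.
move=> [Da [A [Da_neq0 Av]]] [Dz [Z [Dz_neq0 Zv]]].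
pose l1 (M : 'M[int]_d.+1) : R := \sum_i \sum_j `|(M i j)%:~R|.
have l1_ge0 M : 0 <= l1 M by do 2!apply: sumr_ge0 => ? _.
have col_le_l1 (M : 'M[int]_d.+1) j : \sum_i `|(M i j)%:~R| <= l1 M.
  by apply: ler_sum => i _; rewrite (bigD1 j) //= lerDl sumr_ge0.
exists Da, Dz, (l1 A), (l1 Z); split => //; elim=> [|n [M [Mv leM]]].
  exists A; split=> [|i j]; first by rewrite !expr0 !mulr1.
  rewrite expr0 mulr1; apply: le_trans (col_le_l1 _ j).
  by rewrite (bigD1 i) //= lerDl sumr_ge0.
exists (M *m Z); split=> [|i j].
  rewrite map_mxM -mulmxA Zv -scalemxAr Mv scalerA; congr (_ *: _).
  by rewrite !exprS; ring.
rewrite mxE rmorph_sum /=; apply: le_trans (ler_norm_sum _ _ _) _.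
rewrite exprSr mulrA.
apply: le_trans (ler_wpM2l (mulr_ge0 (l1_ge0 A) (exprn_ge0 n (l1_ge0 Z))) (col_le_l1 Z j)).
by rewrite mulr_sumr; apply: ler_sum => k _; rewrite rmorphM normrM /= ler_wpM2r.
Qed.

(** Integers [m] at distance at least [1] are harmless; the other ones satisfy
    [`|m| <= `|alpha| * `|zeta| ^+ n + 1], so that subtracting the scalar
    matrix of [m] keeps the entries of the matrix exponentially bounded. *)
Lemma liouville_power {R : realType} (alpha zeta : R) :
    algebraic_real alpha -> algebraic_real zeta ->
  exists c k : R, [/\ 1 <= c, 1 <= k
    & forall (n : nat) (m : int), alpha * zeta ^+ n != m%:~R ->
        1 <= `|alpha * zeta ^+ n - m%:~R| * (c * k ^+ n)].
Proof.
move=> alg_alpha alg_zeta.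
have [d [v [v00 v_free alpha_v zeta_v]]] := integral_model alpha zeta alg_alpha alg_zeta.
have [Da [Dz [C [K [Da_neq0 Dz_neq0 C_ge0 K_ge0 powers]]]]] :=
  powers_represented d v alpha zeta alpha_v zeta_v.
pose V : R := \sum_i `|v i 0|.
have V_ge0 : 0 <= V by apply: sumr_ge0.
pose C' := C + `|Da%:~R| * (`|alpha| + 1); pose K' := K + `|Dz%:~R| * (`|zeta| + 1).
have C'_ge0 : 0 <= C' by rewrite addr_ge0 ?mulr_ge0 ?addr_ge0.
have K'_ge0 : 0 <= K' by rewrite addr_ge0 ?mulr_ge0 ?addr_ge0.
pose c0 := `|Da%:~R| * (d`!%:R * C' ^+ d * V); pose k0 := `|Dz%:~R| * K' ^+ d.
have c0_ge0 : 0 <= c0 by rewrite /c0 !mulr_ge0 ?exprn_ge0.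
have k0_ge0 : 0 <= k0 by rewrite /k0 mulr_ge0 ?exprn_ge0.
(* Adding 1 makes the bound hold also when [x] below has norm at least 1. *)
exists (1 + c0), (1 + k0); split; [by rewrite lerDl | by rewrite lerDl |].
move=> n m neq_m; set x := alpha * zeta ^+ n - m%:~R.
have ck_ge1 : 1 <= (1 + c0) * (1 + k0) ^+ n.
  by rewrite mulr_ege1 ?exprn_ege1 // lerDl.
have [x_ge1|x_lt1] := leP 1 `|x|; first exact: mulr_ege1.
have m_le : `|m%:~R| <= (`|alpha| + 1) * (`|zeta| + 1) ^+ n.
  have -> : m%:~R = alpha * zeta ^+ n - x by rewrite opprB addrC subrK.
  apply: le_trans (ler_normB _ _) _; rewrite mulrDl mul1r lerD //.
    by rewrite normrM normrX ler_wpM2l // lerXn2r ?nnegrE ?addr_ge0 // lerDl.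
  by apply: le_trans (ltW x_lt1) _; rewrite exprn_ege1 // lerDr.
have [M [Mv leM]] := powers n.
pose Y := M - (Da * Dz ^+ n * m)%:M.
have Yv : map_mx intr Y *m v = (Da%:~R * Dz%:~R ^+ n * x) *: v.
  rewrite map_mxB mulmxBl Mv map_scalar_mx mul_scalar_mx -scalerBl; congr (_ *: _).
  by rewrite !rmorphM rmorphXn /= /x; ring.
have Y_le i j : `|(Y i j)%:~R| <= C' * K' ^+ n.
  rewrite !mxE rmorphB /=; apply: le_trans (ler_normB _ _) _.
  rewrite mulrDl lerD //.
    apply: le_trans (leM i j) _; rewrite ler_wpM2l //.
    by rewrite lerXn2r ?nnegrE // lerDl mulr_ge0 ?addr_ge0.
  apply: (@le_trans _ _ `|(Da * Dz ^+ n * m)%:~R|).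
    by case: (i == j); rewrite ?mulr1n // mulr0n normr0.
  rewrite !rmorphM rmorphXn /= !normrM normrX.
  rewrite -!mulrA ler_wpM2l //.
  apply: le_trans (ler_wpM2l (exprn_ge0 n (normr_ge0 _)) m_le) _.
  rewrite mulrCA ler_wpM2l ?addr_ge0 // -exprMn lerXn2r ?nnegrE //.
  by rewrite lerDr.
have x_neq0 : Da%:~R * Dz%:~R ^+ n * x != 0.
  by rewrite !mulf_neq0 ?expf_neq0 ?intr_eq0 ?subr_eq0.
apply: le_trans (eigenvalue_lower_bound d v Y _ _ v00 v_free Yv x_neq0 Y_le) _.
have -> : `|Da%:~R * Dz%:~R ^+ n * x| * (d`!%:R * (C' * K' ^+ n) ^+ d * V)
          = `|x| * (c0 * k0 ^+ n).
  by rewrite /c0 /k0 !normrM normrX !exprMn -!exprM (mulnC n d); ring.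
rewrite ler_wpM2l // ler_pM ?exprn_ge0 //; first by rewrite lerDr.
by rewrite lerXn2r ?nnegrE ?addr_ge0 // lerDr.
Qed.

(** * Infinitely many integer values *)

(** Since [denq r ^+ k] is prime to [numq r ^+ k], it divides [b]; for [k] at
    least [`|b|] this leaves no room for a denominator greater than [1]. *)
Lemma rat_int_of_powers (r : rat) (b : int) :
    b != 0 -> (forall k0, exists2 k, (k0 <= k)%N & b%:~R * r ^+ k \is a Num.int) ->
  r \is a Num.int.
Proof.
move=> b_neq0 int_powers.
have [k le_bk /intrP[c Dc]] := int_powers `|b|%N.
have den_dvd : (denq r ^+ k %| b)%Z.
  rewrite -(@Gauss_dvdzl _ _ (numq r ^+ k)); last first.
    rewrite coprimezXl // coprimezXr // coprimezE coprime_sym.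
    exact: coprime_num_den.
  apply/dvdzP; exists c; apply/eqP; rewrite -(eqr_int rat) !rmorphM !rmorphXn /= -Dc.
  by rewrite numqE exprMn mulrA.
suff den1 : denq r = 1 by rewrite -(divq_num_den r) den1 divr1 intr_int.
have den_gt0 := denq_gt0 r; apply/eqP; rewrite -[denq r]gez0_abs ?ltW //.
apply: contraT => den_neq1.
have den_gt1 : (1 < `|denq r|)%N.
  by rewrite ltn_neqAle eq_sym absz_gt0 denq_neq0 andbT; apply: contra den_neq1 => /eqP->.
have := dvdn_leq _ den_dvd; rewrite absz_gt0 b_neq0 abszX => /(_ isT).
rewrite leqNgt => /negP[]; apply: leq_ltn_trans le_bk _.
exact: ltn_expl.
Qed.

(** The quotient of two nonzero integer values, at the exponents [g] and [h],
    is the rational number [zeta ^+ L] with [L = h - g].  The remaining integer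
    values, raised to the power [L], force this rational to be an integer [M];
    then [zeta] is the [L]-th root of [M], and the value at [g] gives
    [alpha]. *)
Lemma exceptional_of_integer_values {R : realType} (alpha zeta : R) :
    alpha != 0 -> 1 < zeta ->
    (forall n0, exists2 n, (n0 <= n)%N & alpha * zeta ^+ n \is a Num.int) ->
  exists L M g A B : int,
    [/\ [/\ 0 < L, 0 < M & 0 < g], A != 0, B != 0,
        alpha = A%:~R / B%:~R * M%:~R `^ (- (g%:~R / L%:~R))
      & zeta = M%:~R `^ (1 / L%:~R)].
Proof.
move=> alpha_neq0 zeta_gt1 int_values; have zeta_gt0 : 0 < zeta by apply: lt_trans zeta_gt1.
have [g g_gt0 /intrP[a Da]] := int_values 1%N.
have [h gt_hg /intrP[a' Da']] := int_values g.+1.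
pose L := (h - g)%N; have L_gt0 : (0 < L)%N by rewrite subn_gt0.
have a_neq0 : a != 0.
  by rewrite -(intr_eq0 R) -Da mulf_neq0 // expf_neq0 // gt_eqF.
pose r : rat := a'%:~R / a%:~R.
have zetaL : zeta ^+ L = ratr r.
  rewrite /r rmorphM fmorphV /= !ratr_int -Da -Da' -(subnK (ltnW gt_hg)) exprD -/L.
  by rewrite mulrCA mulfK // Da intr_eq0.
have /intrP[M DM] : r \is a Num.int.
  (* Raising [b := alpha * zeta ^+ n] to the power [L] turns [zeta ^+ (n - g)]
     into a power of [r] even when [L] does not divide [n - g]:
     [b ^+ L = a ^+ L * r ^+ (n - g)]. *)
  apply: (@rat_int_of_powers _ (a ^+ L)); first exact: expf_neq0.
  move=> k0; have [n le_n /intrP[b Db]] := int_values (g + k0)%N.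
  exists (n - g)%N; first by rewrite leq_subRL // (leq_trans _ le_n) ?leq_addr.
  apply/intrP; exists (b ^+ L); apply: (fmorph_inj (ratr : {rmorphism rat -> R})).
  rewrite /= rmorphM rmorphXn /= -zetaL !ratr_int !rmorphXn /= -Da -Db.
  rewrite -[in RHS](subnK (leq_trans (leq_addr k0 g) le_n)) !exprMn -!exprM.
  by rewrite mulrAC -mulrA -exprD mulnC -mulnDl.
rewrite DM ratr_int in zetaL.
have M_gt0 : 0 < M by rewrite -(ltr0z R) -zetaL exprn_gt0.
have zetaE : zeta = M%:~R `^ (1 / L%:~R).
  rewrite -zetaL -powR_mulrn ?ltW // -powRrM mulrA mulr1 divff ?powRr1 ?ltW //.
  by rewrite pnatr_eq0 -lt0n.
exists L%:Z, M, g%:Z, a, 1; split => //.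
have -> : - (g%:~R / L%:~R) = 1 / L%:~R * - g%:R :> R by rewrite mul1r mulrN mulrC.
rewrite powRrM -zetaE powRN powR_mulrn ?ltW // divr1 -Da mulfK //.
by rewrite expf_neq0 // gt_eqF.
Qed.

(** * From lower bounds on distances to the limit superior *)

Lemma dist_int_ge {R : realType} (x delta : R) :
  (forall m : int, delta <= `|x - m%:~R|) -> delta <= dist_int x.
Proof.
move=> le_delta; apply: lb_le_inf; first by exists `|x - 0%:~R|, 0.
by move=> _ [m _ <-].
Qed.

Lemma sigma_bar_lty {R : realType} (alpha zeta s : R) (n0 : nat) :
    (forall n, (n0 <= n)%N -> (sigma_quot alpha zeta n.+1 <= s%:E)%E) ->
  (sigma_bar alpha zeta < +oo)%E.
Proof.
move=> le_s; apply: (@le_lt_trans _ _ s%:E); last exact: ltry.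
apply: le_trans (ereal_inf_lbound _) (_ : (ereal_sup _ <= _)%E).
  by exists [set n | (n0 <= n)%N]%classic; first by exists n0.
by apply: ge_ereal_sup => _ [n /= le_n <-]; apply: le_s.
Qed.

(** The exponent [n.+1] is positive, so the contribution [ln c] of the constant
    factor, divided by [n.+1], is at most [ln c]. *)
Lemma sigma_quot_le {R : realType} (alpha zeta c k : R) (n : nat) :
    1 < zeta -> 1 <= c -> 1 <= k ->
    (forall m : int, 1 <= `|alpha * zeta ^+ n.+1 - m%:~R| * (c * k ^+ n.+1)) ->
  (sigma_quot alpha zeta n.+1 <= ((ln c + ln k) / ln zeta)%:E)%E.
Proof.
move=> zeta_gt1 c_ge1 k_ge1 far.
have c_gt0 : 0 < c by apply: lt_le_trans c_ge1.
have k_gt0 : 0 < k by apply: lt_le_trans k_ge1.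
have ck_gt0 : 0 < c * k ^+ n.+1 by rewrite mulr_gt0 ?exprn_gt0.
have le_dist : (c * k ^+ n.+1)^-1 <= dist_int (alpha * zeta ^+ n.+1).
  by apply: dist_int_ge => m; rewrite -div1r ler_pdivrMr.
have dist_gt0 : 0 < dist_int (alpha * zeta ^+ n.+1).
  by apply: lt_le_trans le_dist; rewrite invr_gt0.
rewrite /sigma_quot gt_eqF // lee_fin.
have lnz_gt0 : 0 < ln zeta by rewrite ln_gt0.
rewrite invfM mulrA ler_pM2r ?invr_gt0 // ler_pdivrMr ?ltr0Sn //.
have : - ln (dist_int (alpha * zeta ^+ n.+1)) <= ln (c * k ^+ n.+1).
  by rewrite lerNl -lnV ?posrE // ler_ln ?posrE ?invr_gt0.
move=> /le_trans; apply.
rewrite lnM ?posrE ?exprn_gt0 // lnXn // mulrDl !mulr_natr lerD //.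
by rewrite mulrS lerDl mulrn_wge0 ?ln_ge0.
Qed.

Theorem theorem2p45 (R : realType) :
  (forall alpha zeta : R,
     alpha != 0 -> 1 < zeta ->
     algebraic_real alpha -> algebraic_real zeta ->
     ~ (exists L M g A B : int,
          [/\ [/\ 0 < L, 0 < M & 0 < g], A != 0, B != 0,
              alpha = A%:~R / B%:~R * M%:~R `^ (- (g%:~R / L%:~R))
            & zeta = M%:~R `^ (1 / L%:~R)]) ->
     (sigma_bar alpha zeta < +oo)%E)
  /\
  (forall zeta : R,
     1 < zeta -> algebraic_real zeta ->
     ~ (exists L M : int,
          [/\ 0 < L, 0 < M & zeta = M%:~R `^ (1 / L%:~R)]) ->
     forall alpha : R,
       alpha != 0 -> algebraic_real alpha ->
       (sigma_bar alpha zeta < +oo)%E).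
Proof.
have finite (alpha zeta : R) :
    alpha != 0 -> 1 < zeta -> algebraic_real alpha -> algebraic_real zeta ->
    ~ (exists L M g A B : int,
         [/\ [/\ 0 < L, 0 < M & 0 < g], A != 0, B != 0,
             alpha = A%:~R / B%:~R * M%:~R `^ (- (g%:~R / L%:~R))
           & zeta = M%:~R `^ (1 / L%:~R)]) ->
    (sigma_bar alpha zeta < +oo)%E.
  move=> alpha_neq0 zeta_gt1 alg_alpha alg_zeta not_exceptional.
  have [c [k [c_ge1 k_ge1 far]]] := liouville_power alpha zeta alg_alpha alg_zeta.
  have [n0 no_int] : exists n0, forall n, (n0 <= n)%N ->
      alpha * zeta ^+ n \isn't a Num.int.
    apply: contrapT => /forallNP int_values; apply: not_exceptional.
    apply: exceptional_of_integer_values => // n0.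
    have /existsNP[n /not_implyP[le_n /negP]] := int_values n0.
    by rewrite negbK => int_n; exists n.
  apply: (@sigma_bar_lty _ _ _ ((ln c + ln k) / ln zeta) n0) => n le_n.
  apply: sigma_quot_le => // m; apply: far.
  by apply: contra (no_int _ (leqW le_n)) => /eqP->; rewrite intr_int.
split=> [//|zeta zeta_gt1 alg_zeta not_root alpha alpha_neq0 alg_alpha].
apply: finite => // -[L [M [g [A [B [[L_gt0 M_gt0 _] _ _ _ zetaE]]]]]].
by apply: not_root; exists L, M.
Qed.
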